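(* Let $Q$ be a finite irreducible reversible generator, with all objects defined from $Q,\nu,\Lambda$ as in the context. For every $t\ge 0$ and $s=\Lambda t$, $$\widehat T_t=e^{t\widehat Q^{T}}=e^{-s}\,B^{-1}W_sB,$$ and consequently, for every initial probability law $\pi_0$ (a column vector in $\mathbb{R}^M$) with embedding $\widehat\pi_0:=\binom{\pi_0}{0}\in\mathbb{R}^{2M}$, $$\pi_t=T_t\pi_0=\Gamma\bigl(e^{-s}\,B^{-1}W_sB\,\widehat\pi_0\bigr),\qquad s=\Lambda t.$$
   Context: Let $M\ge 2$ and let $Q=(Q_{ij})_{1\le i,j\le M}$ be the generator of an irreducible continuous-time Markov chain: $Q_{ij}\ge0$ for $i\neq j$ and $Q_{ii}=-\sum_{j\ne i}Q_{ij}$. Let $\nu$ be its unique stationary probability vector (strictly positive, $Q^{T}\nu=0$), and assume reversibility (detailed balance): $\nu_iQ_{ij}=\nu_jQ_{ji}$ for all $i,j$. Laws are column vectors and the semigroup is $T_t=e^{tQ^{T}}$, $\pi_t=T_t\pi_0$. Fix $\Lambda>0$ with $\Lambda\ge\max_i(-Q_{ii})$ and set $P:=\mathrm{I}+\tfrac1\Lambda Q$, $D:=\mathrm{diag}(\sqrt{\nu_1},\dots,\sqrt{\nu_M})$, $A:=DPD^{-1}$ (real symmetric by reversibility). The doubled chain on $2M$ states is given by $\widehat P=\begin{pmatrix}0&P\\P&0\end{pmatrix}$, $\widehat Q=\Lambda(\widehat P-\mathrm{I}_{2M})$, $\widehat T_t=e^{t\widehat Q^{T}}$. Let $\widehat D=\mathrm{diag}(D,D)$,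 $V=\mathrm{diag}(\mathrm{I}_M,i\,\mathrm{I}_M)$, $B:=V\widehat D^{-1}$. Let $K:=\begin{pmatrix}0&-iA\\ iA&0\end{pmatrix}$ and $W_z:=e^{zK}$ for $z\in\mathbb{C}$. The marginal projection is $\Gamma\binom{x^{+}}{x^{-}}:=x^{+}+x^{-}$ for $x^\pm$ of length $M$. *)

(* Defs.v *)
From HB Require Import structures.
From mathcomp Require Import all_boot all_order all_algebra.
From mathcomp Require Import complex.
From mathcomp Require Import boolp classical_sets functions reals topology.
From mathcomp Require Import normedtype sequences exp.

Set Implicit Arguments.
Unset Strict Implicit.
Unset Printing Implicit Defensive.

Import Order.TTheory GRing.Theory Num.Theory.
Import numFieldNormedType.Exports.
Local Open Scope classical_set_scope.
Local Open Scope ring_scope.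

(* The limit is taken in the normed space of matrices over F (sup norm of the
   entries); F is used below both with a real field R and with R[i]. *)
Definition expmx (F : numFieldType) (n : nat) (X : 'M[F]_n) : 'M[F]_n :=
  lim (series (fun k : nat => (k`!%:R)^-1 *: X ^+ k) @ \oo).

Section Chain.
Variables (R : realType) (n : nat).
Implicit Types (Q : 'M[R]_n) (nu p : 'cV[R]_n) (Lam t : R).

Definition is_generator Q : Prop :=
  (forall i j, i != j -> 0 <= Q i j) /\
  (forall i, Q i i = - \sum_(j | j != i) Q i j).

Definition irreducible_generator Q : Prop :=
  forall i j, connect (fun k l => (k != l) && (0 < Q k l)) i j.

Definition is_law p : Prop :=
  (forall i, 0 <= p i 0) /\ \sum_i p i 0 = 1.

(* For an irreducible generator such a vector exists, is unique and has
   positive entries. *)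
Definition is_stationary Q nu : Prop := is_law nu /\ Q^T *m nu = 0.

Definition detailed_balance Q nu : Prop :=
  forall i j, nu i 0 * Q i j = nu j 0 * Q j i.

Definition semigroup Q t : 'M[R]_n := expmx (t *: Q^T).

Definition law_at Q p t : 'cV[R]_n := semigroup Q t *m p.

Definition Pmx Q Lam : 'M[R]_n := 1%:M + Lam^-1 *: Q.

Definition Dmx nu : 'M[R]_n := diag_mx (\row_i Num.sqrt (nu i 0)).

Definition Amx Q nu Lam : 'M[R]_n := Dmx nu *m Pmx Q Lam *m invmx (Dmx nu).

End Chain.

Section Doubled.
Variables (R : realType) (n : nat).
Implicit Types (Q : 'M[R]_n) (nu p : 'cV[R]_n) (Lam : R).

Definition toC (a b : nat) (X : 'M[R]_(a, b)) : 'M[R[i]]_(a, b) :=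
  map_mx (real_complex R) X.

Definition Phat Q Lam : 'M[R]_(n + n) :=
  block_mx 0 (Pmx Q Lam) (Pmx Q Lam) 0.

Definition Qhat Q Lam : 'M[R]_(n + n) := Lam *: (Phat Q Lam - 1%:M).

Definition Dhat nu : 'M[R]_(n + n) := block_mx (Dmx nu) 0 0 (Dmx nu).

Definition Vmx : 'M[R[i]]_(n + n) := block_mx 1%:M 0 0 ('i%C)%:M.

Definition Bmx nu : 'M[R[i]]_(n + n) := Vmx *m invmx (toC (Dhat nu)).

Definition Kmx Q nu Lam : 'M[R[i]]_(n + n) :=
  block_mx 0 (- 'i%C *: toC (Amx Q nu Lam))
           ('i%C *: toC (Amx Q nu Lam)) 0.

Definition Wmx Q nu Lam (z : R[i]) : 'M[R[i]]_(n + n) :=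
  expmx (z *: Kmx Q nu Lam).

Definition embed p : 'cV[R]_(n + n) := col_mx p 0.

End Doubled.

Definition marginal (F : nmodType) (n : nat) (x : 'cV[F]_(n + n)) : 'cV[F]_n :=
  usubmx x + dsubmx x.

(* Main.v *)
Require Import Defs.
From HB Require Import structures.
From mathcomp Require Import all_boot all_order all_algebra.
From mathcomp Require Import complex.
From mathcomp Require Import boolp classical_sets functions reals topology.
From mathcomp Require Import normedtype sequences exp.
Set Implicit Arguments.
Unset Strict Implicit.
Unset Printing Implicit Defensive.
Import Order.TTheory GRing.Theory Num.Theory.
Import numFieldNormedType.Exports.
Local Open Scope classical_set_scope.
Local Open Scope ring_scope.

(** Detailed balance says that conjugating P by D = diag (sqrt nu) gives a
    matrix A with D A = P^T D, since D^2 P = P^T D^2.  Hence D-hat intertwines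
    the off-diagonal block matrix (0 A; A 0) with P-hat^T.  Conjugating by
    V = diag (I, i I) turns (0 A; A 0) into K, the factors i and 1/i producing
    the opposite signs in its two blocks.  Altogether B P-hat^T = K B
    ([Bmx_intertwine]).  As t Q-hat^T = s P-hat^T - s I and the two summands
    commute, the exponential of the sum is e^{-s} times exp (s P-hat^T)
    ([expmxD], [expmx_scalar]), and the latter is B^{-1} exp (s K) B
    ([expmx_intertwine]).

    For the marginal law, Gamma is left multiplication by G = (I I), and
    G Q-hat^T = Q^T G ([Qhat_intertwine]): swapping the two copies is invisible
    after summation, so the doubled chain lumps onto the original one.
    Exponentiating, G T-hat_t = T_t G, and G sends the embedded law to pi_0.

    The exponential is a limit of partial sums, so each step needs convergence.
    Over the reals it follows by comparing entries with the scalar exponential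
    series.  Over R[i] it is inherited: the series of s K is conjugate to the
    image of a real series ([cvg_expmx_conj], [is_cvg_series_map_expmx]).
    The commuting sum formula is obtained by bounding the tail of the Cauchy
    product entrywise by the corresponding real tail, which tends to 0 because
    the real exponential is already known to be multiplicative.

    Finally, D is invertible because irreducibility and detailed balance force
    nu to be positive ([reversible_law_gt0]). *)

(** * Entrywise convergence of matrices *)

Lemma cvg_mxP (F : numFieldType) m n (T : Type) (G : set_system T) {FG : Filter G}
   (u : T -> 'M[F]_(m, n)) (L : 'M[F]_(m, n)) :
  (u @ G --> L) <-> forall i j, (fun x => u x i j) @ G --> L i j.
Proof.
split=> [uL i j|uL].
  exact: (cvg_comp u (fun M : 'M[F]_(m, n) => M i j) uL
           (@coord_continuous F m n i j L)).
apply/cvg_ballP => e e0; rewrite /ball /= /mx_ball.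
have : \forall x \near G, forall ij : 'I_m * 'I_n,
    ball (L ij.1 ij.2) e (u x ij.1 ij.2).
  apply: filter_forall => -[i j] /=.
  by move: e e0; apply/cvg_ballP; exact: uL.
by apply: filterS => x ux; split => // i j; exact: (ux (i, j)).
Qed.

Lemma cvg_mulmx (F : numFieldType) m n p (T : Type) (G : set_system T)
   {FG : Filter G}
   (u : T -> 'M[F]_(m, n)) (v : T -> 'M[F]_(n, p)) (L : 'M[F]_(m, n)) (L' : 'M[F]_(n, p)) :
  u @ G --> L -> v @ G --> L' -> (fun x => u x *m v x) @ G --> L *m L'.
Proof.
move=> /cvg_mxP uL /cvg_mxP vL; apply/cvg_mxP => i j.
rewrite mxE; under eq_fun do rewrite mxE.
apply: cvg_big => [|k _]; [exact: add_continuous|apply: cvgM; [exact: uL|exact: vL]].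
Qed.

(** * Exponential series and intertwining *)

Definition expmx_coeff (F : numFieldType) n (X : 'M[F]_n) (k : nat) : 'M[F]_n :=
  (k`!%:R)^-1 *: X ^+ k.

Lemma expmxE (F : numFieldType) n (X : 'M[F]_n) :
  expmx X = lim (series (expmx_coeff X) @ \oo).
Proof. by []. Qed.

Lemma mulmx_expr_intertwine (F : pzRingType) m n (G : 'M[F]_(m, n))
    (X : 'M[F]_n) (Y : 'M[F]_m) k :
  G *m X = Y *m G -> G *m X ^+ k = Y ^+ k *m G.
Proof.
move=> GX; elim: k => [|k IH]; first by rewrite !expr0 mulmx1 mul1mx.
rewrite exprSr -[X ^+ k * X]/(X ^+ k *m X) mulmxA IH -mulmxA GX mulmxA.
by rewrite exprSr.
Qed.

(** Rectangular [G] is allowed: an invertible [G] gives invariance under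
    conjugation, and a wide [G] gives lumping of states. *)
Lemma expmx_intertwine (F : numFieldType) m n (G : 'M[F]_(m, n))
    (X : 'M[F]_n) (Y : 'M[F]_m) :
  cvg (series (expmx_coeff X) @ \oo) -> cvg (series (expmx_coeff Y) @ \oo) ->
  G *m X = Y *m G -> G *m expmx X = expmx Y *m G.
Proof.
move=> cX cY GX.
have GS k : G *m series (expmx_coeff X) k = series (expmx_coeff Y) k *m G.
  rewrite /series /= mulmx_sumr mulmx_suml; apply: eq_bigr => l _.
  by rewrite -scalemxAr -scalemxAl (mulmx_expr_intertwine _ GX).
have GXX : (fun k => G *m series (expmx_coeff X) k) @ \oo --> G *m expmx X.
  by apply: cvg_mulmx cX; exact: cvg_cst.
have YYG : (fun k => series (expmx_coeff Y) k *m G) @ \oo --> expmx Y *m G.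
  by apply: cvg_mulmx cY _; exact: cvg_cst.
rewrite -(norm_cvg_lim GXX) -(norm_cvg_lim YYG).
by congr (lim (_ @ \oo)); apply/funext.
Qed.

(** This gives convergence over R[i]: the series of [s *: K] is conjugate to the
    image of a real series. *)
Lemma cvg_expmx_conj (F : numFieldType) n (B X Y : 'M[F]_n) :
  B \in unitmx -> B *m X = Y *m B ->
  cvg (series (expmx_coeff X) @ \oo) -> cvg (series (expmx_coeff Y) @ \oo).
Proof.
move=> uB BX cX.
have -> : series (expmx_coeff Y) =
    (fun k => B *m series (expmx_coeff X) k *m invmx B).
  apply/funext => k; rewrite /series /= mulmx_sumr mulmx_suml.
  apply: eq_bigr => l _; rewrite -scalemxAr -scalemxAl.
  by rewrite (mulmx_expr_intertwine _ BX) mulmxK.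
apply: cvgP; apply: cvg_mulmx; last exact: cvg_cst.
by apply: cvg_mulmx cX; exact: cvg_cst.
Qed.

(** * Cauchy products of exponential series *)

(** The change of indices is [(m, i) = (k + l, l)]. *)
Lemma big_triangle (V : nmodType) (f : nat -> nat -> V) N :
  \sum_(0 <= m < N) \sum_(0 <= i < m.+1) f (m - i)%N i =
  \sum_(0 <= l < N) \sum_(0 <= k < N | (k + l < N)%N) f k l.
Proof.
rewrite (eq_big_nat _ _ (F2 := fun m => \sum_(0 <= i < N | (i < m.+1)%N) f (m - i)%N i)).
  rewrite (exchange_big_dep_nat xpredT) //=; apply: eq_big_nat => i /andP[_ iN].
  rewrite -(big_nat_widenl i 0 N xpredT (fun m => f (m - i)%N i)) //.
  rewrite -{1}(add0n i) big_addn.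
  rewrite (big_nat_widen 0 (N - i) N) ?leq_subr//.
  by apply: eq_big => [k|k _]; [rewrite ltn_subRL addnC|rewrite addnK].
by move=> m /andP[_ mN]; rewrite (big_nat_widen 0 m.+1 N).
Qed.

Lemma expmx_coeffD (F : numFieldType) n (X Y : 'M[F]_n) m : X *m Y = Y *m X ->
  expmx_coeff (X + Y) m =
  \sum_(0 <= i < m.+1) expmx_coeff X (m - i) *m expmx_coeff Y i.
Proof.
move=> XY; rewrite /expmx_coeff exprDn_comm // scaler_sumr big_mkord.
apply: eq_bigr => -[i im] _ /=.
rewrite -[RHS]scalemxAl -scalemxAr -[_ *+ 'C(m, i)]scaler_nat !scalerA.
congr (_ *: _).
rewrite -(bin_fact (im : (i <= m)%N)) natrM invfM mulrAC mulVf; last first.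
  by rewrite pnatr_eq0 -lt0n bin_gt0.
by rewrite mul1r natrM invfM mulrC.
Qed.

(** The terms of [series (expmx_coeff (X + Y)) N] are those of the product of
    partial sums lying below the antidiagonal, so only the upper triangle of
    the square of indices survives in the difference. *)
Lemma series_expmx_coeff_tail (F : numFieldType) n (X Y : 'M[F]_n) N : X *m Y = Y *m X ->
  series (expmx_coeff X) N *m series (expmx_coeff Y) N
    - series (expmx_coeff (X + Y)) N =
  \sum_(0 <= l < N) \sum_(0 <= k < N | ~~ (k + l < N)%N)
     expmx_coeff X k *m expmx_coeff Y l.
Proof.
move=> XY; rewrite /series /= mulmx_sumr.
rewrite [X in _ - X](eq_big_nat _ _ (fun m _ => expmx_coeffD m XY)).
rewrite (big_triangle (fun k l => expmx_coeff X k *m expmx_coeff Y l)) -sumrB.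
apply: eq_bigr => l _; rewrite mulmx_suml.
by rewrite (bigID (fun k => (k + l < N)%N)) /= addrC addrK.
Qed.

(** * Real matrices *)

Section Real.
Variable R : realType.

(** This norm dominates every column sum of absolute values, which is what one
    more right factor [X] costs in the entrywise bounds below. *)
Definition mx_sumnorm m n (X : 'M[R]_(m, n)) : R := \sum_i \sum_j `|X i j|.

Lemma mx_sumnorm_ge0 m n (X : 'M[R]_(m, n)) : 0 <= mx_sumnorm X.
Proof. by apply: sumr_ge0 => i _; exact: sumr_ge0. Qed.

Lemma col_le_mx_sumnorm m n (X : 'M[R]_(m, n)) j : \sum_i `|X i j| <= mx_sumnorm X.
Proof.
by apply: ler_sum => i _; rewrite (bigD1 j)//= lerDl sumr_ge0.
Qed.

(** With [A] = 1 this bounds the coefficients of the exponential series, and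
    with [A] such a coefficient it bounds the terms of a Cauchy product.  Starting
    from the entries of [A] rather than from a norm of 1 keeps any dimension
    factor out, so the bounds are exactly terms of scalar exponential series. *)
Lemma ler_norm_mulmxX m n (A : 'M[R]_(m, n)) (X : 'M[R]_n) a k :
  (forall i j, `|A i j| <= a) -> forall i j, `|(A *m X ^+ k) i j| <= a * mx_sumnorm X ^+ k.
Proof.
move=> Aa; elim: k => [|k IH] i j; first by rewrite !expr0 mulmx1 mulr1.
rewrite !exprSr mulrA -[X ^+ k * X]/(X ^+ k *m X) mulmxA mxE.
apply: le_trans (ler_norm_sum _ _ _) _.
apply: (@le_trans _ _ (\sum_l (a * mx_sumnorm X ^+ k) * `|X l j|)).
  by apply: ler_sum => l _; rewrite normrM ler_wpM2r.
rewrite -mulr_sumr ler_wpM2l ?col_le_mx_sumnorm//.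
by rewrite mulr_ge0 ?exprn_ge0 ?mx_sumnorm_ge0 // (le_trans _ (Aa i j)).
Qed.

Lemma ler_norm_expmx_coeff n (X : 'M[R]_n) k i j :
  `|expmx_coeff X k i j| <= exp_coeff (mx_sumnorm X) k.
Proof.
have := @ler_norm_mulmxX _ _ 1%:M X 1 k _ i j.
rewrite mul1mx mul1r mxE normrM mulrC [X in _ * X]ger0_norm ?invr_ge0// => h.
rewrite /exp_coeff /= ler_wpM2r ?invr_ge0//; apply: h => i' j'.
by rewrite mxE normr_nat lern1 leq_b1.
Qed.

Lemma is_cvg_series_expmx_coeff n (X : 'M[R]_n) :
  cvg (series (expmx_coeff X) @ \oo).
Proof.
have cX i j : cvg ((fun k => series (expmx_coeff X) k i j) @ \oo).
  rewrite (_ : (fun k => _) = series (fun k => expmx_coeff X k i j)); last first.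
    by apply/funext => k; rewrite /series /= summxE.
  apply: normed_cvg; apply: series_le_cvg (is_cvg_series_exp_coeff (mx_sumnorm X)).
  - by move=> k; exact: normr_ge0.
  - by move=> k; rewrite exp_coeff_ge0 ?mx_sumnorm_ge0.
  - by move=> k; exact: ler_norm_expmx_coeff.
apply/cvg_ex; exists (\matrix_(i, j) lim ((fun k => series (expmx_coeff X) k i j) @ \oo)).
by apply/cvg_mxP => i j; rewrite mxE; exact: cX.
Qed.

Lemma expmx_coeff_scalar n (x : R) k :
  expmx_coeff (x%:M : 'M[R]_n) k = (exp_coeff x k)%:M.
Proof. by rewrite /expmx_coeff -rmorphXn /= scale_scalar_mx mulrC. Qed.

Lemma series_expmx_coeff_scalar n (x : R) N :
  series (expmx_coeff (x%:M : 'M[R]_n)) N = (series (exp_coeff x) N)%:M.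
Proof.
rewrite /series /= raddf_sum; apply: eq_bigr => k _; exact: expmx_coeff_scalar.
Qed.

Lemma expmx_scalar n (x : R) : expmx (x%:M : 'M[R]_n) = (expR x)%:M.
Proof.
rewrite expmxE; apply: norm_cvg_lim.
apply/cvg_mxP => i j.
under eq_fun do rewrite series_expmx_coeff_scalar mxE.
by rewrite mxE; apply: cvgMn; exact: is_cvg_series_exp_coeff.
Qed.

(** The case of 1 x 1 matrices. *)
Lemma series_exp_coeff_tail (x y : R) N :
  series (exp_coeff x) N * series (exp_coeff y) N
    - series (exp_coeff (x + y)) N =
  \sum_(0 <= l < N) \sum_(0 <= k < N | ~~ (k + l < N)%N)
     exp_coeff x k * exp_coeff y l.
Proof.
have := @series_expmx_coeff_tail _ 1 x%:M y%:M N (scalar_mxC _ _).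
rewrite -raddfD /= !series_expmx_coeff_scalar -scalar_mxM -raddfB /=.
move=> /matrixP/(_ 0 0); rewrite mxE eqxx mulr1n => ->.
rewrite summxE; apply: eq_bigr => l _; rewrite summxE; apply: eq_bigr => k _.
by rewrite !expmx_coeff_scalar -scalar_mxM mxE eqxx.
Qed.

(** The difference between the product of partial sums and the partial sum of
    the sum is bounded entrywise by the same difference for the real numbers
    [mx_sumnorm X] and [mx_sumnorm Y], which vanishes in the limit by [expRD]. *)
Lemma expmxD n (X Y : 'M[R]_n) : X *m Y = Y *m X ->
  expmx (X + Y) = expmx X *m expmx Y.
Proof.
move=> XY; set x := mx_sumnorm X; set y := mx_sumnorm Y.
have tail0 : (fun N => series (exp_coeff x) N * series (exp_coeff y) N
    - series (exp_coeff (x + y)) N) @ \oo --> (0 : R).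
  rewrite -(subrr (expR (x + y))) {1}expRD.
  apply: cvgB; last exact: is_cvg_series_exp_coeff.
  by apply: cvgM; exact: is_cvg_series_exp_coeff.
have diff0 : (fun N => series (expmx_coeff X) N *m series (expmx_coeff Y) N
    - series (expmx_coeff (X + Y)) N) @ \oo --> (0 : 'M[R]_n).
  apply/cvg_mxP => i j; rewrite mxE.
  apply/norm_cvg0P; apply: squeeze_cvgr tail0; last exact: cvg_cst.
  near=> N; rewrite normr_ge0 /= series_expmx_coeff_tail // series_exp_coeff_tail.
  rewrite summxE; apply: le_trans (ler_norm_sum _ _ _) _; apply: ler_sum => l _.
  rewrite summxE; apply: le_trans (ler_norm_sum _ _ _) _; apply: ler_sum => k _.
  rewrite {2}/expmx_coeff -scalemxAr mxE normrM ger0_norm ?invr_ge0//.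
  rewrite {2}/exp_coeff /= mulrA mulrC ler_wpM2r ?invr_ge0//.
  by apply: ler_norm_mulmxX => i' j'; exact: ler_norm_expmx_coeff.
have prodXY : (fun N => series (expmx_coeff X) N *m series (expmx_coeff Y) N)
    @ \oo --> expmx X *m expmx Y.
  by apply: cvg_mulmx; exact: is_cvg_series_expmx_coeff.
have sumXY : series (expmx_coeff (X + Y)) @ \oo --> expmx (X + Y).
  exact: is_cvg_series_expmx_coeff.
apply: (@norm_cvg_unique _ _ _ _ _ _ sumXY).
rewrite -[expmx X *m expmx Y]subr0.
rewrite (_ : series _ = (fun N => series (expmx_coeff X) N *m series (expmx_coeff Y) N -
  (series (expmx_coeff X) N *m series (expmx_coeff Y) N
    - series (expmx_coeff (X + Y)) N))).
  exact: cvgB.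
by apply/funext => N; rewrite subKr.
Unshelve. all: by end_near. Qed.

End Real.

(** * Change of scalars *)

Section Map.
Variables (R : realType) (F : numFieldType) (f : {rmorphism R -> F}).
Hypothesis f_cont : continuous f.

Lemma map_expmx_coeff n (X : 'M[R]_n) k :
  map_mx f (expmx_coeff X k) = expmx_coeff (map_mx f X) k.
Proof.
rewrite /expmx_coeff map_mxZ fmorphV rmorph_nat; congr (_ *: _).
elim: k => [|k IH]; first by rewrite !expr0 map_mx1.
by rewrite !exprSr -IH; exact: map_mxM.
Qed.

Lemma cvg_series_map_expmx n (X : 'M[R]_n) :
  series (expmx_coeff (map_mx f X)) @ \oo --> map_mx f (expmx X).
Proof.
have -> : series (expmx_coeff (map_mx f X)) =
    (fun N => map_mx f (series (expmx_coeff X) N)).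
  apply/funext => N; rewrite /series /= raddf_sum; apply: eq_bigr => k _.
  exact/esym/map_expmx_coeff.
have /cvg_mxP cX := @is_cvg_series_expmx_coeff _ _ X.
apply/cvg_mxP => i j; rewrite mxE; under eq_fun do rewrite mxE.
exact: (cvg_comp _ f (cX i j) (@f_cont _)).
Qed.

Lemma is_cvg_series_map_expmx n (X : 'M[R]_n) :
  cvg (series (expmx_coeff (map_mx f X)) @ \oo).
Proof. by apply: cvgP; exact: cvg_series_map_expmx. Qed.

Lemma map_expmx n (X : 'M[R]_n) : map_mx f (expmx X) = expmx (map_mx f X).
Proof. by rewrite -(norm_cvg_lim (@cvg_series_map_expmx _ X)). Qed.

End Map.

(** The norm of [x%:C] is the absolute value of [x], and a positive element of
    R[i] has zero imaginary part: balls around real points pull back to balls. *)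
Lemma continuous_real_complex (R : realType) :
  continuous (real_complex R : R -> (R[i] : numFieldType)).
Proof.
move=> l; apply/cvgrPdist_lt => e; rewrite ltcE => /andP[/= /eqP e_im e_gt0].
have /cvgrPdist_lt/(_ _ e_gt0) := @cvg_id _ (nbhs l); apply: filterS => x.
by rewrite -rmorphB /= normc_def /= expr0n addr0 sqrtr_sqr ltcE /= e_im eqxx.
Qed.

(** * The reversible chain and its doubling *)

Section Chain.
Variables (R : realType) (n : nat) (Q : 'M[R]_n) (nu : 'cV[R]_n) (Lam : R).

(** Some state has positive mass, and detailed balance propagates positivity
    along every edge: if [0 < nu k] and [0 < Q k l], then [nu l * Q l k] is
    positive.  Irreducibility reaches every state. *)
Lemma reversible_law_gt0 : irreducible_generator Q -> is_law nu ->
  detailed_balance Q nu -> forall i, 0 < nu i 0.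
Proof.
move=> irrQ [nu_ge0 nu_sum1] dbQ i.
have [k nuk] : exists k, 0 < nu k 0.
  apply/not_existsP => nu_le0; move/eqP: nu_sum1.
  rewrite big1 => [|k _]; first by rewrite eq_sym oner_eq0.
  by apply/eqP; rewrite eq_le nu_ge0 andbT leNgt; apply/negP/nu_le0.
have /connectP[p pth ->] := irrQ k i.
elim: p k nuk pth => [//|l p IH] k nuk /= /andP[/andP[_ Qkl] pth].
apply: IH pth; rewrite lt_neqAle nu_ge0 andbT eq_sym; apply/negP => /eqP nul.
by have := dbQ k l; rewrite nul mul0r => /eqP; rewrite mulf_eq0 !gt_eqF.
Qed.

Lemma Dmx_unit : (forall i, 0 < nu i 0) -> Dmx nu \in unitmx.
Proof.
move=> nu_gt0; rewrite unitmxE det_diag unitfE; apply/prodf_neq0 => i _.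
by rewrite mxE gt_eqF // sqrtr_gt0.
Qed.

Lemma Dmx_sq : (forall i, 0 < nu i 0) -> Dmx nu *m Dmx nu = diag_mx nu^T.
Proof.
move=> nu_gt0; rewrite mulmx_diag; congr diag_mx; apply/rowP => i.
by rewrite !mxE -expr2 sqr_sqrtr // ltW.
Qed.

Lemma detailed_balance_Pmx : detailed_balance Q nu ->
  diag_mx nu^T *m Pmx Q Lam = (Pmx Q Lam)^T *m diag_mx nu^T.
Proof.
move=> dbQ; apply/matrixP => i j; rewrite mul_diag_mx mul_mx_diag !mxE.
rewrite mulrDr mulrDl mulrCA dbQ mulrCA; congr (_ + _).
  by rewrite [j == i]eq_sym; case: eqP => [->|]; rewrite ?mulr0 ?mul0r ?mulr1 ?mul1r.
by rewrite mulrC.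
Qed.

(** This is [D^2 P = P^T D^2] cancelled by [D] on the right. *)
Lemma Dmx_Amx : (forall i, 0 < nu i 0) -> detailed_balance Q nu ->
  Dmx nu *m Amx Q nu Lam = (Pmx Q Lam)^T *m Dmx nu.
Proof.
move=> nu_gt0 dbQ; rewrite /Amx !mulmxA Dmx_sq // detailed_balance_Pmx //.
by rewrite -Dmx_sq // mulmxA mulmxK ?Dmx_unit.
Qed.

Lemma Dhat_unit : (forall i, 0 < nu i 0) -> Dhat nu \in unitmx.
Proof.
move=> nu_gt0; rewrite unitmxE det_ublock unitrM -!unitmxE.
by rewrite Dmx_unit.
Qed.

Lemma Vmx_unit : Vmx R n \in unitmx.
Proof.
rewrite unitmxE det_ublock det1 mul1r det_scalar unitrX // unitfE.
by rewrite eq_complex /= oner_eq0 andbF.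
Qed.

Lemma trmx_Phat : (Phat Q Lam)^T = block_mx 0 (Pmx Q Lam)^T (Pmx Q Lam)^T 0.
Proof. by rewrite /Phat tr_block_mx trmx0. Qed.

Lemma Dhat_Amx : (forall i, 0 < nu i 0) -> detailed_balance Q nu ->
  Dhat nu *m block_mx 0 (Amx Q nu Lam) (Amx Q nu Lam) 0
  = (Phat Q Lam)^T *m Dhat nu.
Proof.
move=> nu_gt0 dbQ; rewrite trmx_Phat /Dhat !mulmx_block.
by rewrite !(mulmx0, mul0mx, addr0, add0r) Dmx_Amx.
Qed.

(** The lower left blocks are both ['i *: A]; the upper right ones are [A] and
    [(- 'i * 'i) *: A]. *)
Lemma Kmx_Vmx :
  Kmx Q nu Lam *m Vmx R n =
  Vmx R n *m toC (block_mx 0 (Amx Q nu Lam) (Amx Q nu Lam) 0).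
Proof.
rewrite /toC map_block_mx map_mx0 /Kmx /Vmx !mulmx_block.
rewrite !(mulmx0, mul0mx, addr0, add0r, mulmx1, mul1mx).
rewrite mul_mx_scalar mul_scalar_mx scalerA mulrN -expr2 sqr_i opprK scale1r.
by [].
Qed.

Lemma Bmx_unit : (forall i, 0 < nu i 0) -> Bmx nu \in unitmx.
Proof.
move=> nu_gt0; rewrite unitmx_mul Vmx_unit unitmx_inv.
by rewrite /toC map_unitmx Dhat_unit.
Qed.

Lemma Bmx_intertwine : (forall i, 0 < nu i 0) -> detailed_balance Q nu ->
  Bmx nu *m toC (Phat Q Lam)^T = Kmx Q nu Lam *m Bmx nu.
Proof.
move=> nu_gt0 dbQ.
have uD : toC (Dhat nu) \in unitmx by rewrite /toC map_unitmx Dhat_unit.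
rewrite /Bmx mulmxA Kmx_Vmx -!mulmxA; congr (_ *m _).
apply: (canRL (mulmxK uD)); rewrite -mulmxA; apply: (canLR (mulKmx uD)).
by rewrite /toC -!map_mxM Dhat_Amx.
Qed.

(** Strong lumpability: [row_mx 1 1] adds the two copies of each state, and
    forgetting the copy, the doubled chain moves according to [Q] from both. *)
Lemma Qhat_intertwine : Lam != 0 ->
  row_mx 1%:M 1%:M *m (Qhat Q Lam)^T = Q^T *m row_mx 1%:M 1%:M.
Proof.
move=> Lam0; have PQ : Lam *: ((Pmx Q Lam)^T - 1%:M) = Q^T.
  rewrite /Pmx [(_ + _)^T]raddfD /= trmx1 [1%:M + _]addrC addrK.
  by rewrite linearZ /= scalerA mulfV // scale1r.
rewrite /Qhat linearZ linearB /= trmx1 trmx_Phat -scalemxAr mulmxBr mulmx1.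
rewrite mul_row_block !(mulmx0, mul1mx, addr0, add0r) mul_mx_row mulmx1.
by rewrite opp_row_mx add_row_mx scale_row_mx PQ.
Qed.

End Chain.

Lemma marginalE (F : pzRingType) n (x : 'cV[F]_(n + n)) :
  marginal x = row_mx 1%:M 1%:M *m x.
Proof. by rewrite -{2}[x]vsubmxK mul_row_col !mul1mx. Qed.

Theorem theorem4p1 (R : realType) (M : nat) (Q : 'M[R]_M) (nu : 'cV[R]_M)
  (Lam : R)
  (hM : (2 <= M)%N)
  (hgen : is_generator Q)
  (hirr : irreducible_generator Q)
  (hstat : is_stationary Q nu)
  (hrev : detailed_balance Q nu)
  (hLam0 : 0 < Lam)
  (hLam : forall i, - Q i i <= Lam)
  (t : R) (ht : 0 <= t) :
  let s := Lam * t in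
  let B := Bmx nu in
  let W := Wmx Q nu Lam in
  toC (semigroup (Qhat Q Lam) t)
    = (expR (- s))%:C%C *: (invmx B *m W s%:C%C *m B) /\
  (forall pi0 : 'cV[R]_M, is_law pi0 ->
     toC (law_at Q pi0 t)
       = marginal ((expR (- s))%:C%C *:
                     (invmx B *m W s%:C%C *m B *m toC (embed pi0)))).
Proof.
move=> s B W.
have nu_gt0 := reversible_law_gt0 hirr hstat.1 hrev.
have uB : B \in unitmx by exact: Bmx_unit.
have That : toC (semigroup (Qhat Q Lam) t)
    = (expR (- s))%:C%C *: (invmx B *m W s%:C%C *m B).
  have -> : semigroup (Qhat Q Lam) t =
      expR (- s) *: expmx (s *: (Phat Q Lam)^T).
    rewrite /semigroup /Qhat linearZ linearB /= trmx1 scalerA -/s [t * Lam]mulrC.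
    rewrite scalerBr -scaleNr scalemx1 expmxD; last by rewrite scalar_mxC.
    by rewrite expmx_scalar mul_mx_scalar.
  have BK : B *m toC (s *: (Phat Q Lam)^T) = (s%:C%C *: Kmx Q nu Lam) *m B.
    by rewrite /toC map_mxZ -scalemxAr -scalemxAl Bmx_intertwine.
  have cX := @is_cvg_series_map_expmx _ _ _ (@continuous_real_complex R) _
    (s *: (Phat Q Lam)^T).
  rewrite -[invmx B *m _ *m B]mulmxA.
  rewrite -[W _ *m B](expmx_intertwine cX (cvg_expmx_conj uB BK cX) BK).
  rewrite mulKmx // [LHS]map_mxZ; congr (_ *: _); apply: map_expmx.
  exact: continuous_real_complex.
split=> // pi0 _.
rewrite scalemxAl -That marginalE.
have -> : row_mx 1%:M 1%:M = toC (row_mx 1%:M 1%:M : 'M[R]_(M, M + M)).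
  by rewrite /toC map_row_mx map_mx1.
rewrite /toC -!map_mxM /law_at /semigroup mulmxA.
rewrite (@expmx_intertwine _ _ _ _ _ (t *: Q^T)) //.
- by rewrite -mulmxA /embed mul_row_col !mul1mx addr0.
- exact: is_cvg_series_expmx_coeff.
- exact: is_cvg_series_expmx_coeff.
- by rewrite -scalemxAr -scalemxAl Qhat_intertwine // gt_eqF.
Qed.
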